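(* Let $(\mathscr{K},\otimes,1)$ be a tensor triangulated category. Let $\mathfrak{S}$ be the set of those subsets $Y\subset\operatorname{Spc}(\mathscr{K})$ of the form $Y=\bigcup_{i\in I}Y_i$ for closed subsets $Y_i$ of $\operatorname{Spc}(\mathscr{K})$ with $\operatorname{Spc}(\mathscr{K})\smallsetminus Y_i$ quasi-compact for all $i\in I$. Let $\mathfrak{R}$ be the set of radical thick $\otimes$-ideals of $\mathscr{K}$. Then there is an order-preserving (for inclusion) bijection $\mathfrak{S}\to\mathfrak{R}$ given by $$Y\longmapsto\mathscr{K}_Y:=\{a\in\mathscr{K}\mid\operatorname{supp}(a)\subset Y\},$$ whose inverse is $$\mathscr{J}\longmapsto\operatorname{supp}(\mathscr{J}):=\bigcup_{a\in\mathscr{J}}\operatorname{supp}(a).$$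
   Context: All categories are essentially small. A tensor triangulated category $(\mathscr{K},\otimes,1)$ is a triangulated category $\mathscr{K}$ (translation functor $T$) with a symmetric monoidal product $\otimes:\mathscr{K}\times\mathscr{K}\to\mathscr{K}$ which is exact in each variable, with unit $1$. A thick $\otimes$-ideal of $\mathscr{K}$ is a full subcategory $\mathscr{A}$ containing $0$ such that: (a) for any distinguished triangle $a\to b\to c\to Ta$, if two of $a,b,c$ belong to $\mathscr{A}$ then so does the third; (b) if $a\in\mathscr{A}$ and $a\simeq b\oplus c$ in $\mathscr{K}$ then $b,c\in\mathscr{A}$; (c) if $a\in\mathscr{A}$ and $b\in\mathscr{K}$ then $a\otimes b\in\mathscr{A}$. A prime of $\mathscr{K}$ is a thick $\otimes$-ideal $\mathscr{P}\subsetneq\mathscr{K}$ such that $a\otimes b\in\mathscr{P}$ implies $a\in\mathscr{P}$ or $b\in\mathscr{P}$. $\operatorname{Spc}(\mathscr{K})$ is the set of all primes of $\mathscr{K}$, with the Zariski topology, whose closed subsets are the sets $Z(\mathscr{S})=\{\mathscr{P}\in\operatorname{Spc}(\mathscr{K})\mid\mathscr{S}\cap\mathscr{P}=\varnothing\}$ for collections of objects $\mathscr{S}\subset\mathscr{K}$. For an object $a$, $\operatorname{supp}(a)=Z(\{a\})=\{\mathscr{P}\in\operatorname{Spc}(\mathscr{K})\mid a\notin\mathscr{P}\}$. The radical of a thick $\otimes$-ideal $\mathscr{J}$ is $\sqrt{\mathscr{J}}=\{a\in\mathscr{K}\mid\exists\,n\geq1\text{ such that }a^{\otimes n}\in\mathscr{J}\}$;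 $\mathscr{J}$ is called radical if $\sqrt{\mathscr{J}}=\mathscr{J}$. $\mathscr{K}_Y$ denotes the full subcategory on the indicated objects. *)

(* Defs.v *)
From HB Require Import structures.
From mathcomp Require Import all_boot all_order all_algebra.
From mathcomp Require Import all_classical.
From mathcomp Require Import topology.
Set Implicit Arguments.
Unset Strict Implicit.
Unset Printing Implicit Defensive.
Import GRing.Theory.
Local Open Scope classical_set_scope.
Local Open Scope ring_scope.

Declare Scope tt_scope.
Delimit Scope tt_scope with tt.
Local Open Scope tt_scope.

Reserved Notation "g ∘ f" (at level 40, left associativity).
Reserved Notation "a ⊕ b" (at level 50, left associativity).
Reserved Notation "a ⊗ b" (at level 40, left associativity).
Reserved Notation "f ⊗h g" (at level 40, left associativity).

(* [hom a b] being a [zmodType] only adds a choice structure to an abelian group.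
   Objects form a type, hence a set in some universe, so essential smallness is
   not a separate hypothesis. *)
Record additive_category := AdditiveCategory {
  ob :> Type;
  hom : ob -> ob -> zmodType;
  idm : forall a, hom a a;
  compm : forall a b c, hom b c -> hom a b -> hom a c
    where "g ∘ f" := (compm g f);
  compA : forall a b c d (h : hom c d) (g : hom b c) (f : hom a b),
    h ∘ (g ∘ f) = (h ∘ g) ∘ f;
  comp1m : forall a b (f : hom a b), idm b ∘ f = f;
  compm1 : forall a b (f : hom a b), f ∘ idm a = f;
  compDl : forall a b c (g g' : hom b c) (f : hom a b),
    (g + g') ∘ f = g ∘ f + g' ∘ f;
  compDr : forall a b c (g : hom b c) (f f' : hom a b),
    g ∘ (f + f') = g ∘ f + g ∘ f';
  zob : ob;
  zob_initial : forall a (f : hom zob a), f = 0;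
  zob_terminal : forall a (f : hom a zob), f = 0;
  oplus : ob -> ob -> ob;
  inj1 : forall a b, hom a (oplus a b);
  inj2 : forall a b, hom b (oplus a b);
  prj1 : forall a b, hom (oplus a b) a;
  prj2 : forall a b, hom (oplus a b) b;
  prj1_inj1 : forall a b, prj1 a b ∘ inj1 a b = idm a;
  prj2_inj2 : forall a b, prj2 a b ∘ inj2 a b = idm b;
  prj1_inj2 : forall a b, prj1 a b ∘ inj2 a b = 0;
  prj2_inj1 : forall a b, prj2 a b ∘ inj1 a b = 0;
  oplus_id : forall a b,
    inj1 a b ∘ prj1 a b + inj2 a b ∘ prj2 a b = idm (oplus a b)
}.

Arguments hom {_} _ _.
Arguments idm {_} _.
Arguments compm {_ _ _ _} _ _.
Arguments zob {_}.
Arguments oplus {_} _ _.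
Arguments inj1 {_} _ _.
Arguments inj2 {_} _ _.
Arguments prj1 {_} _ _.
Arguments prj2 {_} _ _.

Notation "g ∘ f" := (compm g f) : tt_scope.
Notation "a ⊕ b" := (oplus a b) : tt_scope.

Definition is_iso (C : additive_category) (a b : C) (f : hom a b) : Prop :=
  exists g : hom b a, g ∘ f = idm a /\ f ∘ g = idm b.

Definition isomorphic (C : additive_category) (a b : C) : Prop :=
  exists f : hom a b, is_iso f.

Record functor (C D : additive_category) := Functor {
  fob :> C -> D;
  fmap : forall a b : C, hom a b -> hom (fob a) (fob b);
  fmap1 : forall a, fmap (idm a) = idm (fob a);
  fmapM : forall (a b c : C) (g : hom b c) (f : hom a b),
    fmap (g ∘ f) = fmap g ∘ fmap f
}.

Definition additive_functor (C D : additive_category) (F : functor C D) : Prop :=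
  forall (a b : C) (f g : hom a b), fmap F (f + g) = fmap F f + fmap F g.

Definition functor_id (C : additive_category) : functor C C :=
  @Functor C C id (fun _ _ f => f) (fun=> erefl) (fun _ _ _ _ _ => erefl).

Program Definition functor_comp (C D E : additive_category)
    (G : functor D E) (F : functor C D) : functor C E :=
  @Functor C E (fun a => G (F a)) (fun _ _ f => fmap G (fmap F f)) _ _.
Next Obligation. by move=> * /=; rewrite !fmap1. Qed.
Next Obligation. by move=> * /=; rewrite !fmapM. Qed.

Record nat_iso (C D : additive_category) (F G : functor C D) := NatIso {
  niso :> forall a : C, hom (F a) (G a);
  nisoN : forall (a b : C) (f : hom a b), niso b ∘ fmap F f = fmap G f ∘ niso a;
  niso_iso : forall a, is_iso (niso a)
}.

Definition is_equivalence (C D : additive_category) (F : functor C D) : Prop :=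
  exists G : functor D C,
    inhabited (nat_iso (functor_comp G F) (functor_id C)) /\
    inhabited (nat_iso (functor_comp F G) (functor_id D)).

(* Verdier's axioms; the translation is only assumed to be an equivalence, not
   an automorphism. *)
Record triangulated_category := TriangulatedCategory {
  tri_cat :> additive_category;
  shift : functor tri_cat tri_cat;
  shift_additive : additive_functor shift;
  shift_equivalence : is_equivalence shift;
  distinguished : forall a b c : tri_cat,
    hom a b -> hom b c -> hom c (shift a) -> Prop;
  dist_iso : forall (a b c a' b' c' : tri_cat)
      (u : hom a b) (v : hom b c) (w : hom c (shift a))
      (u' : hom a' b') (v' : hom b' c') (w' : hom c' (shift a'))
      (f : hom a a') (g : hom b b') (h : hom c c'),
    is_iso f -> is_iso g -> is_iso h ->
    g ∘ u = u' ∘ f -> h ∘ v = v' ∘ g -> fmap shift f ∘ w = w' ∘ h ->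
    distinguished u v w -> distinguished u' v' w';
  dist_id : forall a : tri_cat,
    distinguished (idm a) (0 : hom a zob) (0 : hom zob (shift a));
  dist_cone : forall (a b : tri_cat) (u : hom a b),
    exists (c : tri_cat) (v : hom b c) (w : hom c (shift a)), distinguished u v w;
  dist_rotate : forall (a b c : tri_cat)
      (u : hom a b) (v : hom b c) (w : hom c (shift a)),
    distinguished u v w <-> distinguished v w (- fmap shift u);
  dist_morphism : forall (a b c a' b' c' : tri_cat)
      (u : hom a b) (v : hom b c) (w : hom c (shift a))
      (u' : hom a' b') (v' : hom b' c') (w' : hom c' (shift a'))
      (f : hom a a') (g : hom b b'),
    distinguished u v w -> distinguished u' v' w' -> g ∘ u = u' ∘ f ->
    exists h : hom c c', h ∘ v = v' ∘ g /\ fmap shift f ∘ w = w' ∘ h;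
  dist_octahedral : forall (a b c a' b' c' : tri_cat)
      (u : hom a b) (v : hom b c)
      (j : hom b c') (k : hom c' (shift a))
      (l : hom c a') (m : hom a' (shift b))
      (p : hom c b') (q : hom b' (shift a)),
    distinguished u j k -> distinguished v l m -> distinguished (v ∘ u) p q ->
    exists (f : hom c' b') (g : hom b' a'),
      [/\ f ∘ j = p ∘ v, q ∘ f = k, g ∘ p = l, m ∘ g = fmap shift u ∘ q
        & distinguished f g (fmap shift j ∘ m)]
}.

Arguments shift {_}.

Definition exact_functor (K L : triangulated_category) (F : functor K L) : Prop :=
  additive_functor F /\
  exists phi : nat_iso (functor_comp F shift) (functor_comp shift F),
    forall (a b c : K) (u : hom a b) (v : hom b c) (w : hom c (shift a)),
      distinguished u v w ->
      distinguished (fmap F u) (fmap F v) (phi a ∘ fmap F w).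

Record bifunctor (C D E : additive_category) := Bifunctor {
  bob :> C -> D -> E;
  bmap : forall (a a' : C) (b b' : D),
    hom a a' -> hom b b' -> hom (bob a b) (bob a' b');
  bmap1 : forall a b, bmap (idm a) (idm b) = idm (bob a b);
  bmapM : forall (a a' a'' : C) (b b' b'' : D)
      (f' : hom a' a'') (f : hom a a') (g' : hom b' b'') (g : hom b b'),
    bmap (f' ∘ f) (g' ∘ g) = bmap f' g' ∘ bmap f g
}.

Program Definition bifunctor_l (C D E : additive_category) (B : bifunctor C D E)
    (a : C) : functor D E :=
  @Functor D E (B a) (fun _ _ g => bmap B (idm a) g) _ _.
Next Obligation. by move=> * /=; rewrite bmap1. Qed.
Next Obligation. by move=> * /=; rewrite -bmapM comp1m. Qed.

Program Definition bifunctor_r (C D E : additive_category) (B : bifunctor C D E)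
    (b : D) : functor C E :=
  @Functor C E (B^~ b) (fun _ _ f => bmap B f (idm b)) _ _.
Next Obligation. by move=> * /=; rewrite bmap1. Qed.
Next Obligation. by move=> * /=; rewrite -bmapM comp1m. Qed.

Record tt_category := TTCategory {
  tt_tri :> triangulated_category;
  tens : bifunctor tt_tri tt_tri tt_tri
    where "a ⊗ b" := (tens a b) and "f ⊗h g" := (bmap tens f g);
  tunit : tt_tri;
  assoc : forall a b c : tt_tri, hom ((a ⊗ b) ⊗ c) (a ⊗ (b ⊗ c));
  lunit : forall a : tt_tri, hom (tunit ⊗ a) a;
  runit : forall a : tt_tri, hom (a ⊗ tunit) a;
  swap : forall a b : tt_tri, hom (a ⊗ b) (b ⊗ a);
  assoc_iso : forall a b c, is_iso (assoc a b c);
  lunit_iso : forall a, is_iso (lunit a);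
  runit_iso : forall a, is_iso (runit a);
  assocN : forall (a a' b b' c c' : tt_tri)
      (f : hom a a') (g : hom b b') (h : hom c c'),
    assoc a' b' c' ∘ ((f ⊗h g) ⊗h h) = (f ⊗h (g ⊗h h)) ∘ assoc a b c;
  lunitN : forall (a b : tt_tri) (f : hom a b),
    lunit b ∘ (idm tunit ⊗h f) = f ∘ lunit a;
  runitN : forall (a b : tt_tri) (f : hom a b),
    runit b ∘ (f ⊗h idm tunit) = f ∘ runit a;
  swapN : forall (a a' b b' : tt_tri) (f : hom a a') (g : hom b b'),
    swap a' b' ∘ (f ⊗h g) = (g ⊗h f) ∘ swap a b;
  pentagon : forall a b c d : tt_tri,
    assoc a b (c ⊗ d) ∘ assoc (a ⊗ b) c d =
    (idm a ⊗h assoc b c d) ∘ assoc a (b ⊗ c) d ∘ (assoc a b c ⊗h idm d);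
  unit_triangle : forall a b : tt_tri,
    (idm a ⊗h lunit b) ∘ assoc a tunit b = runit a ⊗h idm b;
  hexagon : forall a b c : tt_tri,
    assoc b c a ∘ swap a (b ⊗ c) ∘ assoc a b c =
    (idm b ⊗h swap a c) ∘ assoc b a c ∘ (swap a b ⊗h idm c);
  swapK : forall a b : tt_tri, swap b a ∘ swap a b = idm (a ⊗ b);
  tens_exact_l : forall a, exact_functor (bifunctor_l tens a);
  tens_exact_r : forall b, exact_functor (bifunctor_r tens b)
}.

Arguments tens {_}.
Arguments tunit {_}.

Notation "a ⊗ b" := (tens a b) : tt_scope.

(* Full subcategories are given by their sets of objects. *)
Record thick_ideal (K : tt_category) (A : set K) : Prop := ThickIdeal {
  thick0 : A zob;
  thick_tri3 : forall (a b c : K) (u : hom a b) (v : hom b c) (w : hom c (shift a)),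
    distinguished u v w -> A a -> A b -> A c;
  thick_tri2 : forall (a b c : K) (u : hom a b) (v : hom b c) (w : hom c (shift a)),
    distinguished u v w -> A a -> A c -> A b;
  thick_tri1 : forall (a b c : K) (u : hom a b) (v : hom b c) (w : hom c (shift a)),
    distinguished u v w -> A b -> A c -> A a;
  thick_summand : forall a b c : K, A a -> isomorphic a (b ⊕ c) -> A b /\ A c;
  thick_tens : forall a b : K, A a -> A (a ⊗ b)
}.

Record prime_ideal (K : tt_category) (P : set K) : Prop := PrimeIdeal {
  prime_thick : thick_ideal P;
  prime_proper : P <> setT;
  prime_tens : forall a b : K, P (a ⊗ b) -> P a \/ P b
}.

(* [iterop] makes the first tensor power of [a] equal to [a], and not to
   [a ⊗ tunit]. *)
Definition tens_exp (K : tt_category) (a : K) (n : nat) : K :=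
  iterop n (fun x y => x ⊗ y) a tunit.

Definition radical (K : tt_category) (J : set K) : set K :=
  [set a | exists n : nat, (1 <= n)%N /\ J (tens_exp a n)].

Definition radical_thick_ideals (K : tt_category) : set (set K) :=
  [set J | thick_ideal J /\ radical J = J].

Record Spc (K : tt_category) := MkSpc {
  prime_set :> set K;
  prime_setP : prime_ideal prime_set
}.

HB.instance Definition _ (K : tt_category) := gen_eqMixin (Spc K).
HB.instance Definition _ (K : tt_category) := gen_choiceMixin (Spc K).

Definition Zar (K : tt_category) (S : set K) : set (Spc K) :=
  [set P | S `&` prime_set P = set0].

Definition supp (K : tt_category) (a : K) : set (Spc K) := Zar [set a].

Lemma ZarP (K : tt_category) (S : set K) (P : Spc K) :
  (~` Zar S) P <-> exists2 a, S a & prime_set P a.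
Proof.
rewrite /Zar /= ; split; last first.
  by move=> [a Sa Pa] SP0; have : (S `&` P) a by []; rewrite SP0.
by move=> /eqP /set0P [a [Sa Pa]]; exists a.
Qed.

Lemma suppE (K : tt_category) (a : K) : supp a = [set P | ~ prime_set P a].
Proof.
apply/seteqP; split => P /=.
  by move=> h Pa; have : ([set a] `&` P) a by []; rewrite h.
by move=> nPa; apply/seteqP; split => b //= [-> /nPa].
Qed.

Section ZariskiTopology.
Variable K : tt_category.

Let comp0m (a b c : K) (f : hom a b) : (0 : hom b c) ∘ f = 0.
Proof. by apply: (addrI ((0 : hom b c) ∘ f)); rewrite -compDl !addr0. Qed.

Let compm0 (a b c : K) (f : hom b c) : f ∘ (0 : hom a b) = 0.
Proof. by apply: (addrI (f ∘ (0 : hom a b))); rewrite -compDr !addr0. Qed.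

Let compmN (a b c : K) (f : hom b c) (g : hom a b) : f ∘ (- g) = - (f ∘ g).
Proof.
by apply: (addrI (f ∘ g)); rewrite -compDr !subrr compm0.
Qed.

Let compNm (a b c : K) (f : hom b c) (g : hom a b) : (- f) ∘ g = - (f ∘ g).
Proof.
by apply: (addrI (f ∘ g)); rewrite -compDl !subrr comp0m.
Qed.

Let fmapT0 (a b : K) : fmap shift (0 : hom a b) = 0.
Proof. by apply: (addrI (fmap shift (0 : hom a b))); rewrite -shift_additive !addr0. Qed.

Let dist_comp0 (a b c : K) (u : hom a b) (v : hom b c) (w : hom c (shift a)) :
  distinguished u v w -> v ∘ u = 0.
Proof.
move=> duvw; have [|h [<- _]] := dist_morphism (f := idm a) (g := u) (dist_id a) duvw.
  by [].
exact: compm0.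
Qed.

Let dist_zob (d : K) : distinguished (0 : hom zob d) (idm d) 0.
Proof.
apply/dist_rotate.
have iso1 (x : K) : is_iso (idm x) by exists (idm x); rewrite comp1m.
apply: (dist_iso (iso1 d) (iso1 d) _ _ _ _ (dist_id d)) => //.
  exists (0 : hom (shift zob) zob); rewrite !comp0m; split.
    by rewrite (zob_initial (idm zob)).
  by rewrite -fmap1 (zob_initial (idm zob)) fmapT0.
  by rewrite !comp0m.
by rewrite fmap1 fmapT0 oppr0 comp1m comp0m.
Qed.

Let dist_weak_coker (a b c d : K) (u : hom a b) (v : hom b c) (w : hom c (shift a))
    (x : hom b d) :
  distinguished u v w -> x ∘ u = 0 -> exists h : hom c d, h ∘ v = x.
Proof.
move=> duvw xu0.
have [|h [hv _]] := dist_morphism (f := 0) (g := x) duvw (dist_zob d).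
  by rewrite xu0 comp0m.
by exists h; rewrite hv comp1m.
Qed.

Let dist_shift (a : K) :
  distinguished (0 : hom a zob) (0 : hom zob (shift a)) (- idm (shift a)).
Proof. by rewrite -fmap1; apply/(dist_rotate (idm a) 0 0)/dist_id. Qed.

Let thick_iso (A : set K) (a b : K) :
  thick_ideal A -> A a -> isomorphic a b -> A b.
Proof.
move=> thA Aa [f [g [gf fg]]].
suff : isomorphic a (b ⊕ zob) by case/(thick_summand thA Aa).
exists (inj1 b zob ∘ f), (g ∘ prj1 b zob); split.
  by rewrite compA -(compA g) prj1_inj1 compm1.
rewrite compA -(compA _ f) fg compm1.
have <- := oplus_id b zob.
by rewrite (zob_terminal (prj2 b zob)) compm0 addr0.
Qed.

(* The cone of the zero map [b -> shift a] splits, so it is [shift (a ⊕ b)]. *)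
Lemma thick_oplus (A : set K) (a b : K) :
  thick_ideal A -> A a -> A b -> A (a ⊕ b).
Proof.
move=> thA Aa Ab; have A0 := thick0 thA.
have ATa : A (shift a) := thick_tri3 thA (dist_shift a) Aa A0.
have [c [v [w dvw]]] := dist_cone (0 : hom b (shift a)).
have Ac : A c := thick_tri3 thA dvw Ab ATa.
have dvw' := (dist_rotate _ _ _).1 dvw.
have wv0 := dist_comp0 dvw'.
have [r rv] : exists r : hom c (shift a), r ∘ v = idm (shift a).
  by apply: (dist_weak_coker dvw); rewrite compm0.
have [s0 ws0] : exists s0 : hom (shift b) c, w ∘ s0 = idm (shift b).
  have [|h [_ ]] := dist_morphism (f := idm b) (g := 0) (dist_shift b) dvw.
    by rewrite !comp0m.
  by rewrite fmap1 comp1m => wh; exists (- h); rewrite compmN -wh opprK.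
pose s := s0 - v ∘ (r ∘ s0).
have ws : w ∘ s = idm (shift b).
  by rewrite compDr ws0 compmN compA wv0 comp0m subr0.
have rs : r ∘ s = 0 by rewrite compDr compmN compA rv comp1m subrr.
clearbody s.
have splitc : v ∘ r + s ∘ w = idm c.
  pose e := idm c - v ∘ r - s ∘ w.
  have [|h hw] := @dist_weak_coker _ _ _ _ _ _ _ e dvw'.
    rewrite !compDl !compNm comp1m -!compA rv wv0 compm1 compm0.
    by rewrite subrr sub0r oppr0.
  have h0 : h = 0.
    rewrite -(compm1 h) -ws compA hw !compDl !compNm comp1m -!compA rs ws.
    by rewrite compm0 compm1 subr0 subrr.
  move: hw; rewrite h0 comp0m /e -addrA -opprD => /esym/eqP.
  by rewrite subr_eq0 => /eqP/esym.
have isoc : isomorphic c (shift (a ⊕ b)).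
  exists (fmap shift (inj1 a b) ∘ r + fmap shift (inj2 a b) ∘ w).
  exists (v ∘ fmap shift (prj1 a b) + s ∘ fmap shift (prj2 a b)); split.
    rewrite compDl !compDr -!compA !(compA (fmap shift _) (fmap shift _)) -!fmapM.
    rewrite prj1_inj1 prj1_inj2 prj2_inj1 prj2_inj2 fmapT0 !fmap1.
    rewrite !fmapT0 !comp0m !comp1m !compm0 addr0 add0r.
    exact: splitc.
  rewrite compDl !compDr -!compA !(compA r) !(compA w) rv rs wv0 ws.
  rewrite !comp0m !compm0 addr0 add0r !comp1m -!fmapM -shift_additive oplus_id.
  exact: fmap1.
by apply: (thick_tri1 thA (dist_shift (a ⊕ b)) A0); apply: (thick_iso thA Ac).
Qed.

Let zopen : set (set (Spc K)) := [set U | exists S, U = ~` Zar S].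

Let zopenT : zopen setT.
Proof.
exists setT; apply/seteqP; split => P _ //.
by apply/ZarP; exists zob => //; apply: thick0; exact: prime_thick (prime_setP P).
Qed.

Let zopenI : setI_closed zopen.
Proof.
move=> _ _ [S1 ->] [S2 ->].
exists [set c | exists a b, [/\ S1 a, S2 b & c = a ⊕ b]].
apply/seteqP; split => P.
  move=> [/ZarP[a Sa Pa] /ZarP[b Sb Pb]]; apply/ZarP; exists (a ⊕ b).
    by exists a, b.
  exact: thick_oplus (prime_thick (prime_setP P)) Pa Pb.
move=> /ZarP[_ [a [b [Sa Sb ->]]] Pab].
have [|Pa Pb] := @thick_summand _ _ (prime_thick (prime_setP P)) _ a b Pab.
  by exists (idm _), (idm _); rewrite comp1m.
by split; apply/ZarP; [exists a|exists b].
Qed.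

Let zopen_bigU (I : Type) (f : I -> set (Spc K)) :
  (forall i, zopen (f i)) -> zopen (\bigcup_i f i).
Proof.
move=> fo; exists [set a | exists2 S, S a & exists i, f i = ~` Zar S].
apply/seteqP; split => P.
  move=> [i _]; have [S fS] := fo i; rewrite fS => /ZarP[a Sa Pa].
  by apply/ZarP; exists a => //; exists S => //; exists i.
move=> /ZarP[a [S Sa [i fS]] Pa]; exists i => //.
by rewrite fS; apply/ZarP; exists a.
Qed.

HB.instance Definition _ :=
  isOpenTopological.Build (Spc K) zopenT zopenI zopen_bigU.

Lemma closed_SpcE (Y : set (Spc K)) : closed Y <-> exists S, Y = Zar S.
Proof.
rewrite -openC; split => [[S YS]|[S ->]]; last by exists S.
by exists S; rewrite -(setCK Y) YS setCK.
Qed.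

End ZariskiTopology.

Definition cocompact_closed_unions (K : tt_category) : set (set (Spc K)) :=
  [set Y | exists (I : Type) (F : I -> set (Spc K)),
    (forall i, closed (F i) /\ cover_compact (~` F i)) /\ Y = \bigcup_i F i].

Definition supported_on (K : tt_category) (Y : set (Spc K)) : set K :=
  [set a | supp a `<=` Y].

Definition supp_ideal (K : tt_category) (J : set K) : set (Spc K) :=
  \bigcup_(a in J) supp a.

(* Main.v *)
Require Import Defs.
From mathcomp Require Import all_boot all_classical topology.
From mathcomp Require Import ssralg finmap.
Import Defs.
Set Implicit Arguments.
Unset Strict Implicit.
Unset Printing Implicit Defensive.
Import GRing.Theory.
Local Open Scope classical_set_scope.
Local Open Scope ring_scope.
Local Open Scope tt_scope.

(** The correspondence rests on one prime ideal theorem: a thick ideal that is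
    disjoint from a family of objects containing the unit and closed under
    tensor products lies in a prime disjoint from that family
    ([prime_avoiding]).  As in commutative algebra, an ideal [A] that is maximal
    among the disjoint ones is prime.  The colon ideals [(A : b)], which are
    thick since [_ ⊗ b] is exact and additive, replace generated ideals in that
    argument.

    The prime ideal theorem is used twice.  First, it identifies the complements
    of supports with the quasi-compact opens ([cocompact_suppP]).  The complement
    of [supp a] consists of the primes containing [a], and such sets are closed
    under finite unions, because a prime contains [b ⊗ c] iff it contains [b] or
    [c].  A quasi-compact open is therefore the complement of one support.
    Conversely, if the primes containing [a] are covered by opens, no prime
    containing [a] avoids every object that occurs in the description of the
    cover, so some finite product of these objects lies in the ideal generated
    by [a]; the factors of this product give a finite subcover.  Hence the sets
    [Y] of the correspondence are exactly the unions of supports, and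
    [supp_ideal (supported_on Y) = Y] becomes immediate.

    Second, applied to the products of copies of one object [a], it shows that a
    radical ideal [J] not containing [a] lies in a prime not containing [a]
    ([radical_prime_avoiding]).  So [supp a] is not covered by the supports of
    the objects of [J], which gives [supported_on (supp_ideal J) = J].  Finally
    [supported_on Y] is the intersection of the primes outside [Y], hence a
    radical thick ideal. *)

(** * Additive functors and isomorphic objects *)

Lemma isomorphic_sym (C : additive_category) (a b : C) :
  isomorphic a b -> isomorphic b a.
Proof. by move=> [f [g [gf fg]]]; exists g, f. Qed.

Lemma comp_isomorphic (C : additive_category) (a b c : C) :
  isomorphic a b -> isomorphic b c -> isomorphic a c.
Proof.
move=> [f [g [gf fg]]] [f' [g' [gf' fg']]]; exists (f' ∘ f), (g ∘ g'); split.
  by rewrite compA -(compA g) gf' compm1.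
by rewrite compA -(compA f') fg compm1.
Qed.

Lemma functor_isomorphic (C D : additive_category) (F : functor C D) (a b : C) :
  isomorphic a b -> isomorphic (F a) (F b).
Proof.
move=> [f [g [gf fg]]]; exists (fmap F f), (fmap F g).
by rewrite -!fmapM gf fg !fmap1.
Qed.

Lemma comp0m (C : additive_category) (a b c : C) (f : hom a b) :
  (0 : hom b c) ∘ f = 0.
Proof. by apply: (addrI ((0 : hom b c) ∘ f)); rewrite -compDl !addr0. Qed.

Lemma compm0 (C : additive_category) (a b c : C) (f : hom b c) :
  f ∘ (0 : hom a b) = 0.
Proof. by apply: (addrI (f ∘ (0 : hom a b))); rewrite -compDr !addr0. Qed.

Lemma additive_functor0 (C D : additive_category) (F : functor C D) (a b : C) :
  additive_functor F -> fmap F (0 : hom a b) = 0.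
Proof.
by move=> addF; apply: (addrI (fmap F (0 : hom a b))); rewrite -addF !addr0.
Qed.

Lemma additive_functor_zob (C D : additive_category) (F : functor C D) :
  additive_functor F -> isomorphic zob (F zob).
Proof.
move=> addF; exists 0, 0; rewrite !comp0m; split.
  by rewrite (zob_initial (idm zob)).
by rewrite -fmap1 (zob_initial (idm zob)) additive_functor0.
Qed.

Lemma additive_functor_oplus (C D : additive_category) (F : functor C D)
    (a b : C) :
  additive_functor F -> isomorphic (F (a ⊕ b)) (F a ⊕ F b).
Proof.
move=> addF.
exists (inj1 _ _ ∘ fmap F (prj1 a b) + inj2 _ _ ∘ fmap F (prj2 a b)).
exists (fmap F (inj1 a b) ∘ prj1 _ _ + fmap F (inj2 a b) ∘ prj2 _ _); split.
  rewrite compDl !compDr -!compA !(compA (prj1 _ _)) !(compA (prj2 _ _)).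
  rewrite prj1_inj1 prj1_inj2 prj2_inj1 prj2_inj2 !comp0m !comp1m !compm0.
  by rewrite addr0 add0r -!fmapM -addF oplus_id fmap1.
rewrite compDl !compDr -!compA !(compA (fmap F _) (fmap F _)) -!fmapM.
rewrite prj1_inj1 prj1_inj2 prj2_inj1 prj2_inj2 !fmap1 !(additive_functor0 _ _ addF).
by rewrite !comp0m !comp1m !compm0 addr0 add0r oplus_id.
Qed.

(** * Thick ideals *)

(** An isomorphism [f] fits into the distinguished triangle with third object
    [zob], so axiom (a) transports membership along [f]. *)
Lemma thick_iso (K : tt_category) (A : set K) (a b : K) :
  thick_ideal A -> A a -> isomorphic a b -> A b.
Proof.
move=> thA Aa [f isof].
have iso1 (x : K) : is_iso (idm x) by exists (idm x); rewrite comp1m.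
suff dfab : distinguished f (0 : hom b zob) (0 : hom zob (shift a)).
  exact: (thick_tri2 thA dfab Aa (thick0 thA)).
apply: (dist_iso (iso1 a) isof (iso1 zob) _ _ _ (dist_id a)) => //.
  by rewrite compm0 comp0m.
by rewrite compm0 comp0m.
Qed.

Lemma thick_tensC (K : tt_category) (A : set K) (a b : K) :
  thick_ideal A -> A (a ⊗ b) -> A (b ⊗ a).
Proof.
move=> thA Aab; apply: thick_iso thA Aab _.
by exists (swap a b), (swap b a); rewrite !swapK.
Qed.

Lemma thick_tensA (K : tt_category) (A : set K) (a b c : K) :
  thick_ideal A -> A ((a ⊗ b) ⊗ c) <-> A (a ⊗ (b ⊗ c)).
Proof.
move=> thA; have isoA : isomorphic ((a ⊗ b) ⊗ c) (a ⊗ (b ⊗ c)).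
  by exists (assoc a b c); exact: assoc_iso.
split=> Aabc; first exact: thick_iso thA Aabc isoA.
exact: thick_iso thA Aabc (isomorphic_sym isoA).
Qed.

Lemma thick_tensAC (K : tt_category) (A : set K) (a b c : K) :
  thick_ideal A -> A ((a ⊗ b) ⊗ c) -> A ((a ⊗ c) ⊗ b).
Proof.
move=> thA /(thick_tensA a b c thA) Aabc.
apply/thick_tensA => //; apply: thick_iso thA Aabc _.
apply: (functor_isomorphic (bifunctor_l tens a)).
by exists (swap b c), (swap c b); rewrite !swapK.
Qed.

Lemma thick_tens1 (K : tt_category) (A : set K) (a : K) :
  thick_ideal A -> A (a ⊗ tunit) -> A a.
Proof.
by move=> thA Aa; apply: thick_iso thA Aa _; exists (runit a); exact: runit_iso.
Qed.

(** An ideal containing the unit contains every object; this is why primes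
    avoid the unit. *)
Lemma thick_unit (K : tt_category) (A : set K) (a : K) :
  thick_ideal A -> A tunit -> A a.
Proof.
move=> thA A1; apply: thick_tens1 => //; apply: thick_tensC => //.
exact: thick_tens.
Qed.

Lemma thick_bigcap (K : tt_category) (F : set (set K)) :
  F `<=` @thick_ideal K -> thick_ideal (\bigcap_(A in F) A).
Proof.
move=> thF; split.
- by move=> A /thF/thick0.
- by move=> a b c u v w d Fa Fb A FA; apply: (thick_tri3 (thF A FA) d);
    [exact: Fa|exact: Fb].
- by move=> a b c u v w d Fa Fb A FA; apply: (thick_tri2 (thF A FA) d);
    [exact: Fa|exact: Fb].
- by move=> a b c u v w d Fa Fb A FA; apply: (thick_tri1 (thF A FA) d);
    [exact: Fa|exact: Fb].
- move=> a b c Fa iso_a; split=> A FA;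
  by have [] := thick_summand (thF A FA) (Fa A FA) iso_a.
- by move=> a b Fa A FA; apply: (thick_tens (thF A FA)); exact: Fa.
Qed.

Lemma thick_chain_bigcup (K : tt_category) (F : set (set K)) :
  F !=set0 -> total_on F subset -> F `<=` @thick_ideal K ->
  thick_ideal (\bigcup_(A in F) A).
Proof.
move=> [A0 FA0] totF thF.
have common a b : (\bigcup_(A in F) A) a -> (\bigcup_(A in F) A) b ->
    exists2 A, F A & A a /\ A b.
  move=> [A FA Aa] [B FB Bb]; have [AB|BA] := totF A B FA FB.
    by exists B => //; split=> //; exact: AB.
  by exists A => //; split=> //; exact: BA.
split.
- by exists A0 => //; exact: thick0 (thF _ FA0).
- move=> a b c u v w d Fa Fb; have [A FA [Aa Ab]] := common _ _ Fa Fb.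
  by exists A => //; exact: (thick_tri3 (thF A FA) d Aa Ab).
- move=> a b c u v w d Fa Fb; have [A FA [Aa Ab]] := common _ _ Fa Fb.
  by exists A => //; exact: (thick_tri2 (thF A FA) d Aa Ab).
- move=> a b c u v w d Fa Fb; have [A FA [Aa Ab]] := common _ _ Fa Fb.
  by exists A => //; exact: (thick_tri1 (thF A FA) d Aa Ab).
- move=> a b c [A FA Aa] iso_a.
  have [Ab Ac] := thick_summand (thF A FA) Aa iso_a.
  by split; exists A.
- by move=> a b [A FA Aa]; exists A => //; exact: (thick_tens (thF A FA)).
Qed.

Definition colon (K : tt_category) (A : set K) (b : K) : set K :=
  [set x | A (x ⊗ b)].

Lemma sub_colon (K : tt_category) (A : set K) (b : K) :
  thick_ideal A -> A `<=` colon A b.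
Proof. by move=> thA x Ax; exact: thick_tens. Qed.

(** The preimage of a thick ideal under the exact functor [_ ⊗ b] inherits
    axioms (a) and (b); axiom (c) comes from the symmetry. *)
Lemma thick_colon (K : tt_category) (A : set K) (b : K) :
  thick_ideal A -> thick_ideal (colon A b).
Proof.
move=> thA; have [addb [phi exb]] := tens_exact_r b; split.
- exact: thick_iso thA (thick0 thA) (additive_functor_zob addb).
- by move=> x y z u v w /exb; exact: (thick_tri3 thA).
- by move=> x y z u v w /exb; exact: (thick_tri2 thA).
- by move=> x y z u v w /exb; exact: (thick_tri1 thA).
- move=> x y z Axb /(functor_isomorphic (bifunctor_r tens b)) iso_x.
  apply: (thick_summand thA Axb).
  exact: comp_isomorphic iso_x (additive_functor_oplus y z addb).
- move=> x y Axb; apply: (thick_tensAC thA); exact: thick_tens.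
Qed.

(** * Primes avoiding products of objects *)

(** Keeping all bracketings of a product makes this family closed under tensor
    products on the nose, without associativity isomorphisms. *)
Inductive tens_closure (K : tt_category) (S : set K) : set K :=
| TensUnit : tens_closure S tunit
| TensGen a of S a : tens_closure S a
| TensProd a b of tens_closure S a & tens_closure S b :
    tens_closure S (a ⊗ b).

(** An ideal [A] that is maximal among those containing [J] and disjoint from
    the products is prime.  Indeed suppose that [a ⊗ b] is in [A] but neither
    factor is.  Then [(A : b)] contains [A] strictly, so it contains a product
    [s].  Now [(A : s)] contains [A] and [b], so it contains a product [t], and
    the product [t ⊗ s] lies in [A], a contradiction. *)
Lemma prime_avoiding (K : tt_category) (J S : set K) :
  thick_ideal J -> (forall x, tens_closure S x -> ~ J x) ->
  exists P : Spc K, J `<=` P /\ forall a, S a -> ~ prime_set P a.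
Proof.
move=> thJ JS.
(* The empty chain also needs an upper bound, so the maximal element is sought
   among the [B] for which [J `|` B], rather than [B], is a disjoint ideal. *)
pose good A := thick_ideal A /\ forall x, tens_closure S x -> ~ A x.
have [F goodF totF|B [[thA AS] maxB]] :=
    @Zorn_bigcup K (fun B => good (J `|` B)).
  pose G := [set J `|` B | B in set0 |` F].
  have -> : J `|` \bigcup_(B in F) B = \bigcup_(A in G) A.
    rewrite /G bigcup_image; apply/seteqP; split=> x.
      move=> [Jx|[B FB Bx]]; first by exists set0; left.
      by exists B; right.
    move=> [B [->|FB] [Jx|Bx]] //; by [left|right; exists B].
  have goodG : G `<=` good.
    move=> _ [B [->|FB] <-]; last exact: goodF.
    by rewrite setU0.
  split; last by move=> x Sx [A /goodG[_ AS] /(AS x Sx)].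
  apply: thick_chain_bigcup; last by move=> A /goodG[].
    by exists (J `|` set0); exists set0 => //; left.
  have totF0 : total_on (set0 |` F) subset.
    move=> A B [->|FA] [->|FB]; last exact: totF.
    - by left.
    - by left.
    - by right.
  move=> _ _ [A FA <-] [B FB <-].
  by have [AB|BA] := totF0 A B FA FB; [left|right]; exact: setUS.
set A := J `|` B in thA AS.
have maxA C : thick_ideal C -> A `<=` C -> ~ C `<=` A ->
    exists2 x, tens_closure S x & C x.
  move=> thC AC nCA; apply: contrapT => noS.
  apply: (maxB C).
    split; first by move=> x Bx; apply: AC; right.
    by move=> CB; apply: nCA => x /CB; right.
  have -> : J `|` C = C by apply/setUidr => x Jx; apply: AC; left.
  by split=> // x Sx Cx; apply: noS; exists x.
suff primeA : prime_ideal A.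
  exists (MkSpc primeA); split=> [x Jx|a Sa]; first by left.
  by apply: AS; apply: TensGen.
split=> // [AT|a b Aab].
  by apply: (AS tunit); [exact: TensUnit|rewrite AT].
apply: contrapT => /not_orP[nAa nAb].
have [||s Ss Asb] := maxA _ (thick_colon b thA).
- exact: sub_colon.
- by move=> /(_ a Aab).
have [||t St Ats] := maxA _ (thick_colon s thA).
- exact: sub_colon.
- by move=> /(_ b (thick_tensC thA Asb)).
exact: AS (TensProd St Ss) Ats.
Qed.

(** * Quasi-compact open subsets of the spectrum *)

Lemma prime_set_thick (K : tt_category) (P : Spc K) : thick_ideal P.
Proof. exact: prime_thick (prime_setP P). Qed.

Lemma prime_unit (K : tt_category) (P : Spc K) : ~ prime_set P tunit.
Proof.
move=> P1; apply: (prime_proper (prime_setP P)); apply/seteqP; split=> // x _.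
exact: thick_unit (prime_set_thick P) P1.
Qed.

Lemma prime_setM (K : tt_category) (P : Spc K) (a b : K) :
  prime_set P (a ⊗ b) <-> prime_set P a \/ prime_set P b.
Proof.
have thP := prime_set_thick P; split; first exact: (prime_tens (prime_setP P)).
case=> Px; first exact: thick_tens.
by apply: thick_tensC => //; exact: thick_tens.
Qed.

Lemma not_suppE (K : tt_category) (a : K) :
  ~` supp a = [set P : Spc K | prime_set P a].
Proof. by rewrite suppE; apply: setCK. Qed.

Lemma prime_set_bigtens (K : tt_category) (I : eqType) (s : seq I) (b : I -> K)
    (P : Spc K) :
  prime_set P (\big[(fun x y => x ⊗ y)/tunit]_(i <- s) b i) <->
  exists2 i, i \in s & prime_set P (b i).
Proof.
elim: s => [|i s IHs].
  by rewrite big_nil; split=> [/prime_unit|[]].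
rewrite big_cons; split=> [/prime_setM[Pi|/IHs[j js Pj]]|[j]].
- by exists i; rewrite ?mem_head.
- by exists j; rewrite // in_cons js orbT.
rewrite in_cons => /orP[/eqP->|js] Pj; apply/prime_setM; first by left.
by right; apply/IHs; exists j.
Qed.

(** If the cover consists of the complements [U_i] of [Z(S_i)], then [S] below
    contains every [S_i].  Primes containing a product of objects of [S] lie in
    finitely many of the [U_i], one per factor other than [tunit], and some such
    product lies in the ideal generated by [a], since every prime containing [a]
    lies in some [U_i] and therefore meets [S]. *)
Lemma not_supp_compact (K : tt_category) (a : K) :
  cover_compact (~` supp a).
Proof.
move=> I D f opf; rewrite not_suppE => covf.
pose S : set K := [set b | exists2 i, D i & [set P | prime_set P b] `<=` f i].
pose J : set K := \bigcap_(A in [set A | thick_ideal A /\ A a]) A.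
have thJ : thick_ideal J by apply: thick_bigcap => A [].
have [x Sx Jx] : exists2 x, tens_closure S x & J x.
  apply: contrapT => noS.
  have [|P [JP nPS]] := @prime_avoiding K J S thJ.
    by move=> x Sx Jx; apply: noS; exists x.
  have Pa : prime_set P a by apply: JP => A [].
  have [i Di fiP] := covf P Pa.
  have [T fT] : exists T, ~` f i = Zar T.
    by apply/closed_SpcE; apply: open_closedC; exact: opf.
  have fiE : f i = ~` Zar T by rewrite -fT setCK.
  move: fiP; rewrite {1}fiE => /ZarP[b Tb Pb].
  apply: (nPS b) => //; exists i => // Q Qb.
  by rewrite fiE; apply/ZarP; exists b.
have [E DE fE] : exists2 E : {fset I}, {subset E <= D} &
    [set P : Spc K | prime_set P x] `<=` cover [set` E] f.
  elim: Sx => [|b [i Di fi]|b c _ [E ED Eb] _ [E' ED' Ec]].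
  - by exists fset0 => // P /prime_unit.
  - exists [fset i]%fset; first by move=> j /fset1P ->; apply/mem_set.
    by move=> P /fi fiP; exists i => //; exact: fset11.
  exists (E `|` E')%fset; first by move=> i /fsetUP[/ED|/ED'].
  move=> P /prime_setM[/Eb|/Ec] [i Ei fiP]; exists i => //=;
  by rewrite in_fsetU Ei ?orbT.
by exists E => // P Pa; apply: fE; apply: Jx; split=> //; exact: prime_set_thick.
Qed.

(** An open set is covered by the sets of primes containing one given object;
    a finite subcover is the set of primes containing one product. *)
Lemma cocompact_suppP (K : tt_category) (Z : set (Spc K)) :
  closed Z /\ cover_compact (~` Z) <-> exists a, Z = supp a.
Proof.
split; last first.
  move=> [a ->]; split; last exact: not_supp_compact.
  by apply/closed_SpcE; exists [set a].
move=> [/closed_SpcE[S ->] cptS].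
(* The index type of a cover needs a choice structure, which [{classic K}] puts
   on the objects. *)
pose f (b : {classic K}) : set (Spc K) := ~` supp (b : K).
have [b Sb||E ES fE] := cptS {classic K} S f.
- by apply: closed_openC; apply/closed_SpcE; exists [set (b : K)].
- by move=> P /ZarP[b Sb Pb]; exists b => //; rewrite /f not_suppE.
exists (\big[(fun x y => x ⊗ y)/tunit]_(b <- (E : seq {classic K})) (b : K)).
apply: setC_inj; rewrite not_suppE; apply/seteqP; split=> P.
  move=> /fE[b Eb]; rewrite /f not_suppE => Pb.
  by apply/prime_set_bigtens; exists b.
move=> /prime_set_bigtens[b Eb Pb]; apply/ZarP; exists b => //.
exact/set_mem/ES.
Qed.

(** * Radical ideals and unions of supports *)

Lemma prime_set_tens_exp (K : tt_category) (P : Spc K) (a : K) (n : nat) :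
  (0 < n)%N -> prime_set P (tens_exp a n) -> prime_set P a.
Proof. by elim: n => [|[|n] IHn] // _ /prime_setM[//|]; exact: IHn. Qed.

(** Since [supp a] is the set of primes not containing [a], it lies in [Y] iff
    [a] belongs to every prime outside [Y]. *)
Lemma supported_onE (K : tt_category) (Y : set (Spc K)) :
  supported_on Y = \bigcap_(A in @prime_set K @` (~` Y)) A.
Proof.
apply/seteqP; split=> a /=.
  move=> aY _ [P nYP <-]; apply: contrapT => nPa.
  by apply: nYP; apply: aY; rewrite suppE.
move=> aP P; rewrite suppE => nPa; apply: contrapT => nYP; apply: nPa.
by apply: aP; exists P.
Qed.

Lemma supported_on_radical_thick (K : tt_category) (Y : set (Spc K)) :
  radical_thick_ideals (supported_on Y).
Proof.
rewrite supported_onE; split.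
  by apply: thick_bigcap => _ [P _ <-]; exact: prime_set_thick.
apply/seteqP; split=> a; last by move=> Ya; exists 1%N.
move=> [n [n_gt0 Yan]] _ [P nYP <-]; apply: (prime_set_tens_exp n_gt0).
by apply: Yan; exists P.
Qed.

(** Closure under the square root of [c ⊗ a] lets one replace the factors of a
    product of copies of [a] one at a time, without counting them.  The context
    [c] makes the induction go through. *)
Lemma radical_tens_closure1 (K : tt_category) (J : set K) (a x c : K) :
  radical_thick_ideals J -> tens_closure [set a] x ->
  J (c ⊗ x) -> J (c ⊗ a).
Proof.
move=> [thJ radJ] Sx; elim: Sx c => [c Jc|_ -> //|y z _ IHy _ IHz c Jcyz].
  by apply: (thick_tens thJ); apply: thick_tens1 thJ Jc.
have Jcya : J ((c ⊗ y) ⊗ a) by apply: IHz; apply/thick_tensA.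
have Jcaa : J ((c ⊗ a) ⊗ a) by apply: IHy; exact: thick_tensAC.
rewrite -radJ; exists 2%N; split=> //.
apply/(thick_tensA (c ⊗ a) c a thJ); apply: (thick_tensAC thJ).
exact: (thick_tens thJ).
Qed.

Lemma radical_prime_avoiding (K : tt_category) (J : set K) (a : K) :
  radical_thick_ideals J -> ~ J a ->
  exists P : Spc K, J `<=` P /\ ~ prime_set P a.
Proof.
move=> radJ nJa; have [thJ _] := radJ.
have [x Sx Jx|P [JP nPa]] := @prime_avoiding K J [set a] thJ.
  apply: nJa; apply: (thick_tens1 thJ); apply: thick_tensC => //.
  apply: (radical_tens_closure1 radJ Sx).
  by apply: thick_tensC => //; exact: thick_tens.
by exists P; split=> //; exact: nPa.
Qed.

Lemma supp_ideal_cocompact (K : tt_category) (J : set K) :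
  cocompact_closed_unions (supp_ideal J).
Proof.
exists {a : K | J a}, (fun a => supp (sval a)); split.
  by move=> a; apply/cocompact_suppP; exists (sval a).
apply/seteqP; split=> P; last by move=> [[a Ja] _ Pa]; exists a.
by move=> [a Ja Pa]; exists (exist J a Ja).
Qed.

Lemma supp_idealK (K : tt_category) (Y : set (Spc K)) :
  cocompact_closed_unions Y -> supp_ideal (supported_on Y) = Y.
Proof.
move=> [I [F [qcF ->]]]; apply/seteqP; split=> P.
  by move=> [a aY Pa]; exact: aY.
move=> [i _ FiP]; have [a FiE] := (cocompact_suppP (F i)).1 (qcF i).
exists a; last by rewrite -FiE.
by move=> Q; rewrite -FiE => FiQ; exists i.
Qed.

Lemma supported_onK (K : tt_category) (J : set K) :
  radical_thick_ideals J -> supported_on (supp_ideal J) = J.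
Proof.
move=> radJ; apply/seteqP; split=> a; last by move=> Ja P Pa; exists a.
move=> aJ; apply: contrapT => nJa.
have [P [JP nPa]] := radical_prime_avoiding radJ nJa.
have [|b Jb] := aJ P; first by rewrite suppE.
by rewrite suppE; apply; exact: JP.
Qed.

Theorem theorem4p10 (K : tt_category) :
  [/\ set_bij (@cocompact_closed_unions K) (@radical_thick_ideals K)
        (@supported_on K),
      (forall Y1 Y2 : set (Spc K),
         cocompact_closed_unions Y1 -> cocompact_closed_unions Y2 ->
         Y1 `<=` Y2 -> supported_on Y1 `<=` supported_on Y2),
      set_fun (@radical_thick_ideals K) (@cocompact_closed_unions K)
        (@supp_ideal K),
      (forall Y : set (Spc K), cocompact_closed_unions Y ->
         supp_ideal (supported_on Y) = Y)
    & (forall J : set K, radical_thick_ideals J ->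
         supported_on (supp_ideal J) = J)].
Proof.
split.
- split.
  + by move=> Y _; exact: supported_on_radical_thick.
  + move=> Y1 Y2 /set_mem Y1S /set_mem Y2S eqK.
    by rewrite -(supp_idealK Y1S) eqK supp_idealK.
  + move=> J radJ; exists (supp_ideal J); first exact: supp_ideal_cocompact.
    exact: supported_onK.
- by move=> Y1 Y2 _ _ Y12 a aY1 P /aY1 /Y12.
- by move=> J _; exact: supp_ideal_cocompact.
- exact: supp_idealK.
- exact: supported_onK.
Qed.
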